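(* Let $n\ge 2$, let $\mathbf u=(u^{(1)},\dots,u^{(n-1)})^{\intercal}$ be a smooth $\mathbb R^{n-1}$-valued function of $(x,t)$, let $\nu\in\mathbb R$, and let $L^{01},L^{10}$ be the $\mathfrak o_{n+1}$-valued functions defined in the context. Put $$L=L^{01}+\lambda L^{10},\qquad M=M_3+\lambda M_2+\lambda^2M_1+\lambda^3M_0,$$ with $$M_0=-L^{10},\qquad M_1=-L^{01},\qquad M_2=-D_x[L^{10},L^{01}]+\big(\nu+\tfrac12\langle\mathbf u,\mathbf u\rangle\big)L^{10},$$ $$M_3=D_x^2L^{01}+\big(\nu+\tfrac12\langle\mathbf u,\mathbf u\rangle\big)L^{01}-[L^{01},D_xL^{01}].$$ Then the zero-curvature condition $[D_x+L,\,D_t+M]=0$ (for all values of the parameter $\lambda$) is equivalent to $$\mathbf u_t=\mathbf u_{xxx}+\big(\nu+\tfrac32\langle\mathbf u,\mathbf u\rangle\big)\mathbf u_x.$$ In particular, for $\nu=0$, $(L,M)$ is a Lax pair with values in $\mathfrak o_{n+1}$ whose integrability condition is the vector modified Korteweg–de Vries equation $\mathbf u_t=\mathbf u_{xxx}+\tfrac32\|\mathbf u\|^2\mathbf u_x$.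
   Context: $\mathfrak o_{n+1}$ is the Lie algebra of real antisymmetric $(n+1)\times(n+1)$ matrices. Index rows and columns by $0,1,\dots,n$ and let $E_{ab}$ be the matrix units. Then $$L^{10}=E_{01}-E_{10},\qquad L^{01}=\sum_{i=1}^{n-1}u^{(i)}(E_{1,i+1}-E_{i+1,1}).$$ $D_x,D_t$ are differentiation with respect to $x$ and $t$, $\lambda$ is a parameter independent of $x,t$, $\langle\cdot,\cdot\rangle$ is the standard inner product on $\mathbb R^{n-1}$, $\|\mathbf u\|^2=\langle\mathbf u,\mathbf u\rangle$, and $[D_x+L,D_t+M]=D_xM-D_tL+[L,M]$, where $[L,M]=LM-ML$. *)

(* Defs.v *)
From mathcomp Require Import all_boot all_order all_algebra.
From mathcomp Require Import all_classical all_reals all_analysis.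

Set Implicit Arguments.
Unset Strict Implicit.
Unset Printing Implicit Defensive.

Import Order.TTheory GRing.Theory Num.Theory.
Import numFieldNormedType.Exports.

Local Open Scope classical_set_scope.
Local Open Scope ring_scope.

(* Points of the domain are pairs p = (x, t). *)
Definition Dx (R : realType) (V : normedModType R) (F : R * R -> V)
  : R * R -> V := fun p => 'D_((1, 0) : R * R) F p.

Definition Dt (R : realType) (V : normedModType R) (F : R * R -> V)
  : R * R -> V := fun p => 'D_((0, 1) : R * R) F p.

(* Iterated partial derivatives are indexed by words: true stands for Dx and
   false for Dt. *)
Definition Dword (R : realType) (V : normedModType R) (s : seq bool)
  (F : R * R -> V) : R * R -> V :=
  foldr (fun b G => if b then Dx G else Dt G) F s.

(* C^infinity on U (meant for open U): all iterated partial derivatives, in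
   any order, exist and are continuous at every point of U.  The derivability
   clauses are needed because 'D_v is a total operator. *)
Definition smooth_on (R : realType) (V : normedModType R) (U : set (R * R))
  (F : R * R -> V) : Prop :=
  forall (s : seq bool) (p : R * R), U p ->
    [/\ {for p, continuous (Dword s F)},
        derivable (Dword s F) p ((1, 0) : R * R) &
        derivable (Dword s F) p ((0, 1) : R * R)].

Definition inner (R : realType) (m : nat) (v w : 'cV[R]_m) : R :=
  \sum_(i < m) v i 0 * w i 0.

(* The Euclidean norm; the norm `|v| of the library is the sup norm. *)
Definition norm2 (R : realType) (m : nat) (v : 'cV[R]_m) : R :=
  Num.sqrt (inner v v).

Definition lie (R : realType) (m : nat) (A B : 'M[R]_m) : 'M[R]_m :=
  A *m B - B *m A.

(* The Lie algebra of real antisymmetric matrices. *)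
Definition in_o (R : realType) (m : nat) (A : 'M[R]_m) : Prop := A^T = - A.

(* Matrix unit E_ab, rows and columns indexed by 0, ..., n; inord is faithful
   for a, b <= n. *)
Definition E (R : realType) (n a b : nat) : 'M[R]_n.+1 :=
  delta_mx (inord a) (inord b).

Definition L10 (R : realType) (n : nat) : R * R -> 'M[R]_n.+1 :=
  fun=> E R n 0 1 - E R n 1 0.

(* The component u^(i), 1 <= i <= n-1, is stored at the ordinal of value i-1,
   hence the matrix index i+1 becomes i.+2. *)
Definition L01 (R : realType) (n : nat) (u : R * R -> 'cV[R]_n.-1)
  : R * R -> 'M[R]_n.+1 :=
  fun p => \sum_(i < n.-1) u p i 0 *: (E R n 1 i.+2 - E R n i.+2 1).

Definition M0 (R : realType) (n : nat) : R * R -> 'M[R]_n.+1 :=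
  fun p => - L10 n p.

Definition M1 (R : realType) (n : nat) (u : R * R -> 'cV[R]_n.-1)
  : R * R -> 'M[R]_n.+1 :=
  fun p => - L01 u p.

Definition M2 (R : realType) (n : nat) (nu : R) (u : R * R -> 'cV[R]_n.-1)
  : R * R -> 'M[R]_n.+1 :=
  fun p => - Dx (fun q => lie (L10 n q) (L01 u q)) p
           + (nu + 2^-1 * inner (u p) (u p)) *: L10 n p.

Definition M3 (R : realType) (n : nat) (nu : R) (u : R * R -> 'cV[R]_n.-1)
  : R * R -> 'M[R]_n.+1 :=
  fun p => Dx (Dx (L01 u)) p
           + (nu + 2^-1 * inner (u p) (u p)) *: L01 u p
           - lie (L01 u p) (Dx (L01 u) p).

(* The first argument is the parameter lambda. *)
Definition Lmat (R : realType) (n : nat) (u : R * R -> 'cV[R]_n.-1) (lam : R)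
  : R * R -> 'M[R]_n.+1 :=
  fun p => L01 u p + lam *: L10 n p.

Definition Mmat (R : realType) (n : nat) (nu : R) (u : R * R -> 'cV[R]_n.-1)
  (lam : R) : R * R -> 'M[R]_n.+1 :=
  fun p => M3 nu u p + lam *: M2 nu u p + lam ^+ 2 *: M1 u p
           + lam ^+ 3 *: M0 n p.

(* [D_x + L, D_t + M] *)
Definition curvature (R : realType) (m : nat) (L M : R * R -> 'M[R]_m)
  : R * R -> 'M[R]_m :=
  fun p => Dx M p - Dt L p + lie (L p) (M p).

Definition zero_curvature (R : realType) (m : nat) (U : set (R * R))
  (L M : R -> R * R -> 'M[R]_m) : Prop :=
  forall (lam : R) (p : R * R), U p -> curvature (L lam) (M lam) p = 0.

(* (L, M) is an o_m-valued Lax pair on U whose integrability condition is the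
   equation P. *)
Definition o_lax_pair (R : realType) (m : nat) (U : set (R * R))
  (L M : R -> R * R -> 'M[R]_m) (P : Prop) : Prop :=
  (forall (lam : R) (p : R * R), U p -> in_o (L lam p) /\ in_o (M lam p)) /\
  (zero_curvature U L M <-> P).

(* Main.v *)
Require Import Defs.
From mathcomp Require Import all_boot all_order all_algebra.
From mathcomp Require Import all_classical all_reals all_analysis.
From mathcomp Require Import ring.

Set Implicit Arguments.
Unset Strict Implicit.
Unset Printing Implicit Defensive.

Import Order.TTheory GRing.Theory Num.Theory.
Import numFieldNormedType.Exports.

Local Open Scope classical_set_scope.
Local Open Scope ring_scope.

(** Every matrix in the statement is a combination of wedges
    a ^ b = a b^T - b a^T of column vectors.  With e0, e1 the first two vectors
    of the standard basis and v |-> Pv the isometric embedding of R^(n-1) onto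
    the span of the remaining ones, L10 = e0 ^ e1 and L01 = e1 ^ Pu.  Brackets
    of wedges are given by a single formula in inner products ([lie_wedge]),
    and e0, e1 are orthonormal and orthogonal to the image of P, so with
    f = nu + <u,u>/2
      M2 = - e0 ^ Pu_x + f (e0 ^ e1),
      M3 = e1 ^ Pu_xx + f (e1 ^ Pu) + Pu ^ Pu_x.
    These identities hold on the whole open set U, so they may be
    differentiated there: wedges, inner products and scalings obey the product
    rule, and f_x = <u,u_x>.

    In D_x M - D_t L + [L,M] all positive powers of lambda then cancel
    ([wedge_curvature]); in degree zero the brackets [e1 ^ Pu, M3] contribute
    <u,u> (e1 ^ Pu_x) - <u,u_x> (e1 ^ Pu) - Pu ^ Pu_xx, which turns f into
    f + <u,u> = nu + 3/2 <u,u> and kills the other two terms of D_x M3.  Hence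
    the curvature is
      e1 ^ P(u_xxx + (nu + 3/2 <u,u>) u_x - u_t)
    for every lambda ([curvatureE]).  As v |-> e1 ^ Pv is injective, it
    vanishes exactly when the equation holds. *)

(** * Wedges of column vectors and their brackets *)

Definition wedge (R : realType) (m : nat) (a b : 'cV[R]_m) : 'M[R]_m :=
  a *m b^T - b *m a^T.

Section Algebra.
Variables (R : realType) (m : nat).
Implicit Types (a b c d : 'cV[R]_m) (A B : 'M[R]_m) (k : R).

Lemma wedgeE a b i j : wedge a b i j = a i 0 * b j 0 - b i 0 * a j 0.
Proof. by rewrite !mxE !big_ord1 !mxE. Qed.

Lemma wedgeDr a b c : wedge a (b + c) = wedge a b + wedge a c.
Proof. by apply/matrixP => i j; rewrite [RHS]mxE !wedgeE !mxE; ring. Qed.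

Lemma wedgeZr k a b : wedge a (k *: b) = k *: wedge a b.
Proof. by apply/matrixP => i j; rewrite [RHS]mxE !wedgeE !mxE; ring. Qed.

Lemma wedge0r a : wedge a 0 = 0.
Proof. by rewrite -(scale0r a) wedgeZr scale0r. Qed.

Lemma wedge_sumr a (I : finType) (b : I -> 'cV[R]_m) :
  wedge a (\sum_i b i) = \sum_i wedge a (b i).
Proof.
apply: (big_morph (wedge a)) => [x y|]; [exact: wedgeDr|exact: wedge0r].
Qed.

Lemma wedgeBr a b c : wedge a (b - c) = wedge a b - wedge a c.
Proof. by rewrite -(scaleN1r c) wedgeDr wedgeZr scaleN1r. Qed.

Lemma wedgeC a b : wedge a b = - wedge b a.
Proof. by rewrite /wedge opprB. Qed.

Lemma wedge_refl a : wedge a a = 0.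
Proof. by rewrite /wedge subrr. Qed.

Lemma wedge_antisym a b : in_o (wedge a b).
Proof. by apply/matrixP => i j; rewrite mxE [RHS]mxE !wedgeE; ring. Qed.

Lemma in_oD A B : in_o A -> in_o B -> in_o (A + B).
Proof. by rewrite /in_o => hA hB; rewrite linearD /= hA hB opprD. Qed.

Lemma in_oZ k A : in_o A -> in_o (k *: A).
Proof. by rewrite /in_o => hA; rewrite linearZ /= hA scalerN. Qed.

Lemma in_oN A : in_o A -> in_o (- A).
Proof. by rewrite /in_o => hA; rewrite linearN /= hA. Qed.

Lemma innerC a b : inner a b = inner b a.
Proof. by apply: eq_bigr => i _; rewrite mulrC. Qed.

Lemma inner_delta a (i : 'I_m) : inner (delta_mx i 0) a = a i 0.
Proof.
rewrite /inner (bigD1 i) //= big1 => [|j ji]; rewrite !mxE ?eqxx ?mul1r ?addr0 //.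
by rewrite (negPf ji) mul0r.
Qed.

Lemma norm2_sqr a : norm2 a ^+ 2 = inner a a.
Proof. by rewrite sqr_sqrtr // sumr_ge0 // => i _; rewrite -expr2 sqr_ge0. Qed.

Lemma innerM a b : (inner a b)%:M = a^T *m b.
Proof.
apply/matrixP => i j; rewrite !ord1 !mxE mulr1n.
by apply: eq_bigr => l _; rewrite mxE.
Qed.

Lemma innerE a b : inner a b = (a^T *m b) 0 0.
Proof. by rewrite -innerM mxE mulr1n. Qed.

(** The inner factor b^T c is a 1 x 1 matrix, hence a scalar. *)
Lemma mul_dyad a b c d : a *m b^T *m (c *m d^T) = inner b c *: (a *m d^T).
Proof.
have -> : a *m b^T *m (c *m d^T) = a *m (b^T *m c) *m d^T by rewrite !mulmxA.
by rewrite -innerM mul_mx_scalar scalemxAl.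
Qed.

(** Expanding both products gives eight dyads; the product in the opposite
    order is the transpose of the first one, so they pair up into four
    wedges. *)
Lemma lie_wedge a b c d : lie (wedge a b) (wedge c d) =
  inner b c *: wedge a d - inner b d *: wedge a c
  - inner a c *: wedge b d + inner a d *: wedge b c.
Proof.
rewrite /lie {1 2 3 4}/wedge !(mulmxBl, mulmxBr) !mul_dyad.
rewrite (innerC d) (innerC c a) (innerC c b) (innerC d b).
apply/matrixP => i j; rewrite /wedge !mxE !big_ord1 !mxE; ring.
Qed.

Lemma lieDl A B C : lie (A + B) C = lie A C + lie B C :> 'M[R]_m.
Proof. by rewrite /lie mulmxDl mulmxDr opprD addrACA. Qed.

Lemma lieDr A B C : lie C (A + B) = lie C A + lie C B :> 'M[R]_m.
Proof. by rewrite /lie mulmxDl mulmxDr opprD addrACA. Qed.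

Lemma lieNr A B : lie A (- B) = - lie A B.
Proof. by rewrite /lie mulmxN mulNmx opprB opprK addrC. Qed.

Lemma lieZl k A B : lie (k *: A) B = k *: lie A B.
Proof. by rewrite /lie -scalemxAl -scalemxAr scalerBr. Qed.

Lemma lieZr k A B : lie A (k *: B) = k *: lie A B.
Proof. by rewrite /lie -scalemxAl -scalemxAr scalerBr. Qed.

(** The algebraic content of the zero-curvature computation.  Here a, b, c, d
    stand for the embedded u, u_x, u_xx, u_xxx, w for the embedded u_t and f
    for nu + <u,u>/2; the first three lines are D_x M - D_t L and the bracket
    is [L, M].  Only wedges e1 ^ x with a coefficient free of lam survive. *)
Lemma wedge_curvature e0 e1 a b c d w (f lam : R) :
  inner e0 e0 = 1 -> inner e1 e1 = 1 -> inner e0 e1 = 0 ->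
  (forall x, x \in [:: a; b; c] -> inner e0 x = 0) ->
  (forall x, x \in [:: a; b; c] -> inner e1 x = 0) ->
  (wedge e1 d + (f *: wedge e1 b + inner a b *: wedge e1 a) + wedge a c
   + lam *: (- wedge e0 c + inner a b *: wedge e0 e1) - lam ^+ 2 *: wedge e1 b)
  - wedge e1 w
  + lie (wedge e1 a + lam *: wedge e0 e1)
      (wedge e1 c + f *: wedge e1 a + wedge a b
       + lam *: (- wedge e0 b + f *: wedge e0 e1)
       - lam ^+ 2 *: wedge e1 a - lam ^+ 3 *: wedge e0 e1)
  = wedge e1 (d + (f + inner a a) *: b - w).
Proof.
move=> h00 h11 h01 h0 h1.
have [h0a h0b h0c] : [/\ inner e0 a = 0, inner e0 b = 0 & inner e0 c = 0].
  by split; apply: h0; rewrite !inE eqxx ?orbT.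
have [h1a h1b h1c] : [/\ inner e1 a = 0, inner e1 b = 0 & inner e1 c = 0].
  by split; apply: h1; rewrite !inE eqxx ?orbT.
rewrite wedgeBr wedgeDr wedgeZr.
rewrite lieDl lieZl !(lie_wedge, lieDr, lieNr, lieZr).
rewrite (innerC a e0) (innerC e1 e0) (innerC a e1).
rewrite h00 h11 h01 h0a h0b h0c h1a h1b h1c !wedge_refl (wedgeC e1 e0).
rewrite (wedgeC a e0) (wedgeC a e1).
(* The identity is now linear in the wedges, which become indeterminates. *)
move: (wedge e0 e1) (wedge e1 a) (wedge e1 b) (wedge e1 c) (wedge e1 d).
move: (wedge e1 w) (wedge e0 a) (wedge e0 b) (wedge e0 c) (wedge a b) (wedge a c).
move: (inner a a) (inner a b) (inner a c) => saa sab sac.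
move=> X1 X2 X3 X4 X5 X6 X7 X8 X9 X10 X11.
rewrite !(scale0r, scale1r, scaler0, subr0, add0r, addr0, sub0r).
apply/matrixP => i j.
by rewrite !mxE; ring.
Qed.
End Algebra.

(** * Directional derivatives of matrix-valued functions *)

Section Calculus.
Variables (R : realType) (V : normedModType R).
Implicit Types (x v : V).

Lemma is_derive_mx m n (F : V -> 'M[R]_(m, n)) x v (D : 'M[R]_(m, n)) :
  is_derive x v F D <-> forall i j, is_derive x v (fun q => F q i j) (D i j).
Proof.
split=> [[dF <-] i j|h].
  have dFij := (derivable_mxP F x v).1 dF.
  by apply: DeriveDef => //; rewrite derive_mx // mxE.
have dF : derivable F x v by apply/derivable_mxP => i j; have [] := h i j.
apply: DeriveDef => //; rewrite derive_mx //; apply/matrixP => i j; rewrite mxE.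
by have [] := h i j.
Qed.

Lemma is_derive_sumf (W : normedModType R) n (h : 'I_n -> V -> W) x v
    (dh : 'I_n -> W) :
  (forall k, is_derive x v (h k) (dh k)) ->
  is_derive x v (fun q => \sum_k h k q) (\sum_k dh k).
Proof.
move=> hh; have -> : (fun q => \sum_k h k q) = \sum_k h k.
  by apply/funext => q; rewrite fct_sumE.
exact: is_derive_sum.
Qed.

Lemma is_derive_mulmx m n p (F : V -> 'M[R]_(m, n)) (G : V -> 'M[R]_(n, p)) x v
    (dF : 'M[R]_(m, n)) (dG : 'M[R]_(n, p)) :
  is_derive x v F dF -> is_derive x v G dG ->
  is_derive x v (fun q => F q *m G q) (dF *m G x + F x *m dG).
Proof.
move=> /is_derive_mx hF /is_derive_mx hG; apply/is_derive_mx => i j.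
under eq_fun do rewrite mxE.
apply: is_derive_eq.
  by apply: is_derive_sumf => k; apply: is_deriveM.
rewrite !mxE -big_split /=; apply: eq_bigr => k _.
by rewrite /GRing.scale /=; ring.
Qed.

Lemma is_derive_trmx m n (F : V -> 'M[R]_(m, n)) x v (D : 'M[R]_(m, n)) :
  is_derive x v F D -> is_derive x v (fun q => (F q)^T) D^T.
Proof.
move=> /is_derive_mx h; apply/is_derive_mx => i j; rewrite mxE.
by under eq_fun do rewrite mxE; exact: h.
Qed.

Lemma is_derive_wedge m (a b : V -> 'cV[R]_m) x v (da db : 'cV[R]_m) :
  is_derive x v a da -> is_derive x v b db ->
  is_derive x v (fun q => wedge (a q) (b q)) (wedge da (b x) + wedge (a x) db).
Proof.
move=> ha hb; apply: is_derive_eq.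
  by apply: is_deriveB; apply: is_derive_mulmx => //; exact: is_derive_trmx.
by apply/matrixP => i j; rewrite /wedge !mxE !big_ord1 !mxE; ring.
Qed.

Lemma is_derive_inner m (a b : V -> 'cV[R]_m) x v (da db : 'cV[R]_m) :
  is_derive x v a da -> is_derive x v b db ->
  is_derive x v (fun q => inner (a q) (b q)) (inner da (b x) + inner (a x) db).
Proof.
move=> /is_derive_mx ha /is_derive_mx hb.
apply: is_derive_eq.
  by apply: is_derive_sumf => k; apply: is_deriveM.
rewrite /inner -big_split /=; apply: eq_bigr => k _.
by rewrite /GRing.scale /=; ring.
Qed.

Lemma is_derive_scale m n (f : V -> R) (F : V -> 'M[R]_(m, n)) x v (df : R)
    (dF : 'M[R]_(m, n)) :
  is_derive x v f df -> is_derive x v F dF ->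
  is_derive x v (fun q => f q *: F q) (f x *: dF + df *: F x).
Proof.
move=> hf /is_derive_mx hF; apply/is_derive_mx => i j.
under eq_fun do rewrite mxE.
apply: is_derive_eq.
by rewrite !mxE /GRing.scale /=; ring.
Qed.

End Calculus.


(** * The orthonormal frame carrying L10 and L01 *)

Section Frame.
Variables (R : realType) (n : nat).

Definition frame (a : nat) : 'cV[R]_n.+1 := delta_mx (inord a) 0.

(** Rows 0 and 1 are left free for e0 and e1; inord is faithful because
    k < n.-1 forces k+2 <= n. *)
Definition embed : 'M[R]_(n.+1, n.-1) :=
  \matrix_(i, k) (i == inord k.+2)%:R.

Lemma inord_eq a b : (a <= n)%N -> (b <= n)%N ->
  (inord a == inord b :> 'I_n.+1) = (a == b).
Proof. by move=> an bn; rewrite -val_eqE /= !inordK. Qed.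

Lemma embed_index (k : 'I_n.-1) : (k.+2 <= n)%N.
Proof. by case: n k => [|[|m]] [k hk]. Qed.

Lemma inner_frame a b : (a <= n)%N -> (b <= n)%N ->
  inner (frame a) (frame b) = (a == b)%:R.
Proof. by move=> an bn; rewrite inner_delta mxE eqxx andbT inord_eq. Qed.

Lemma inner_frame_embed a (v : 'cV[R]_n.-1) : (a < 2)%N -> (a <= n)%N ->
  inner (frame a) (embed *m v) = 0.
Proof.
move=> a2 an; rewrite inner_delta mxE big1 // => k _.
rewrite mxE inord_eq ?embed_index //.
by case: a a2 {an} => [|[|]] //; rewrite mul0r.
Qed.

Lemma trmx_embed_mul : embed^T *m embed = 1%:M.
Proof.
apply/matrixP => k l; rewrite mxE (bigD1 (inord k.+2)) //= big1 => [|i ik].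
  by rewrite !mxE eqxx mul1r addr0 inord_eq ?embed_index.
by rewrite !mxE (negPf ik) mul0r.
Qed.

Lemma inner_embed (v w : 'cV[R]_n.-1) :
  inner (embed *m v) (embed *m w) = inner v w.
Proof.
by rewrite !innerE trmx_mul -mulmxA (mulmxA embed^T) trmx_embed_mul mul1mx.
Qed.

Lemma wedge_frame a b : wedge (frame a) (frame b) = E R n a b - E R n b a.
Proof. by rewrite /wedge /frame !trmx_delta !mul_delta_mx. Qed.

Lemma embedE (v : 'cV[R]_n.-1) : embed *m v = \sum_k v k 0 *: frame k.+2.
Proof.
apply/matrixP => i j; rewrite ord1 mxE summxE; apply: eq_bigr => k _.
by rewrite !mxE eqxx andbT mulrC.
Qed.

Lemma L10E p : L10 n p = wedge (frame 0) (frame 1) :> 'M[R]__.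
Proof. by rewrite wedge_frame. Qed.

Lemma L01E (u : R * R -> 'cV[R]_n.-1) p :
  L01 u p = wedge (frame 1) (embed *m u p).
Proof.
rewrite /L01 embedE wedge_sumr; apply: eq_bigr => k _.
by rewrite wedgeZr wedge_frame.
Qed.

(** Multiplying by e1^T on the left recovers the embedded vector, and embed^T
    is a left inverse of embed. *)
Lemma wedge_embed_inj (v : 'cV[R]_n.-1) : (1 <= n)%N ->
  wedge (frame 1) (embed *m v) = 0 -> v = 0.
Proof.
move=> n1 h.
have h0 : embed *m v = 0.
  have : (frame 1)^T *m wedge (frame 1) (embed *m v) = (embed *m v)^T.
    rewrite /wedge mulmxBr (mulmxA _ (frame 1)) (mulmxA _ (embed *m v)).
    rewrite -!innerM inner_frame // inner_frame_embed //.
    by rewrite !mul_scalar_mx scale1r scale0r subr0.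
  by rewrite h mulmx0 => /(congr1 trmx); rewrite trmxK trmx0.
by rewrite -(mul1mx v) -trmx_embed_mul -mulmxA h0 mulmx0.
Qed.

End Frame.

(** * The curvature of the pair *)

Section Curvature.
Variables (R : realType) (n : nat) (n1 : (1 <= n)%N).
Variables (U : set (R * R)) (openU : open U).
Variables (u : R * R -> 'cV[R]_n.-1) (smooth_u : smooth_on U u).

(** Identities that hold on the open set U only can be differentiated at its
    points. *)
Lemma is_derive_on (W : normedModType R) (F G : R * R -> W) (p v : R * R) D :
  (forall q, U q -> F q = G q) -> U p -> is_derive p v G D -> is_derive p v F D.
Proof.
move=> FG Up; apply: near_eq_is_derive.
have : \forall q \near p, U q by exact: open_nbhs_nbhs.
by apply: filterS => q /FG.
Qed.

Lemma is_derive_smooth s p : U p ->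
  is_derive p ((1, 0) : R * R) (Dword s u) (Dx (Dword s u) p) /\
  is_derive p ((0, 1) : R * R) (Dword s u) (Dt (Dword s u) p).
Proof. by move=> Up; have [_ hx ht] := smooth_u s Up; split; exact/derivableP. Qed.

Lemma is_derive_embed (p v : R * R) a (da : 'cV[R]_n.-1) :
  is_derive p v a da ->
  is_derive p v (fun q => embed R n *m a q) (embed R n *m da).
Proof.
move=> ha; have := is_derive_mulmx (is_derive_cst (embed R n) p v) ha.
by rewrite mul0mx add0r.
Qed.

Lemma is_derive_wedge_embed (p v : R * R) (e : 'cV[R]_n.+1) a (da : 'cV[R]_n.-1) :
  is_derive p v a da ->
  is_derive p v (fun q => wedge e (embed R n *m a q)) (wedge e (embed R n *m da)).
Proof.
move=> ha; have := is_derive_wedge (is_derive_cst e p v) (is_derive_embed ha).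
by rewrite wedgeC wedge0r oppr0 add0r.
Qed.

Let e0 := frame R n 0.
Let e1 := frame R n 1.
Let b v : 'cV[R]_n.+1 := embed R n *m v.
(* The scalar coefficient common to M2 and M3. *)
Let energy nu q := nu + 2^-1 * inner (u q) (u q).

Lemma is_derive_energy nu p : U p ->
  is_derive p ((1, 0) : R * R) (energy nu) (inner (u p) (Dx u p)).
Proof.
move=> Up; have [hu _] := is_derive_smooth [::] Up.
have hi := is_derive_inner hu hu.
have := is_deriveD (is_derive_cst nu p ((1, 0) : R * R)) (is_deriveZ 2^-1 hi).
rewrite add0r => h; apply: is_derive_eq h _.
by rewrite (innerC (Dx _ _)) /GRing.scale /=; field.
Qed.

Lemma Dx_L01E p : U p -> Dx (L01 u) p = wedge e1 (b (Dx u p)).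
Proof.
move=> Up; have [hu _] := is_derive_smooth [::] Up.
have -> : L01 u = fun q => wedge e1 (b (u q)) by apply/funext => q; exact: L01E.
by apply: (@derive_val _ _ _ _ _ _ _ (is_derive_wedge_embed e1 hu)).
Qed.

Lemma Dx2_L01E p : U p -> Dx (Dx (L01 u)) p = wedge e1 (b (Dx (Dx u) p)).
Proof.
move=> Up; have [hu _] := is_derive_smooth [:: true] Up.
have h := is_derive_on Dx_L01E Up (is_derive_wedge_embed e1 hu).
by apply: (@derive_val _ _ _ _ _ _ _ h).
Qed.

Lemma Dt_LmatE lam p : U p -> Dt (Lmat u lam) p = wedge e1 (b (Dt u p)).
Proof.
move=> Up; have [_ hu] := is_derive_smooth [::] Up.
have -> : Lmat u lam = fun q => wedge e1 (b (u q)) + lam *: wedge e0 e1.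
  by apply/funext => q; rewrite /Lmat L01E L10E.
have hc := is_derive_cst (lam *: wedge e0 e1) p ((0, 1) : R * R).
rewrite -[RHS]addr0.
by apply: (@derive_val _ _ _ _ _ _ _ (is_deriveD (is_derive_wedge_embed e1 hu) hc)).
Qed.

Lemma M2E nu p : U p ->
  M2 nu u p = - wedge e0 (b (Dx u p)) + energy nu p *: wedge e0 e1.
Proof.
move=> Up; have [hu _] := is_derive_smooth [::] Up.
rewrite /M2 L10E; congr (- _ + _).
have -> : (fun q => lie (L10 n q) (L01 u q)) = fun q => wedge e0 (b (u q)).
  apply/funext => q; rewrite L10E L01E lie_wedge !inner_frame ?inner_frame_embed //.
  by rewrite !scale0r scale1r !subr0 addr0.
by apply: (@derive_val _ _ _ _ _ _ _ (is_derive_wedge_embed e0 hu)).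
Qed.

(** The bracket [e1 ^ Pu, e1 ^ Pu_x] is - Pu ^ Pu_x because e1 is a unit vector
    orthogonal to both. *)
Lemma M3E nu p : U p ->
  M3 nu u p = wedge e1 (b (Dx (Dx u) p)) + energy nu p *: wedge e1 (b (u p))
              + wedge (b (u p)) (b (Dx u p)).
Proof.
move=> Up; rewrite /M3 Dx2_L01E // Dx_L01E // L01E; congr (_ + _ + _).
rewrite lie_wedge (innerC (b (u p)) e1) !inner_frame // !inner_frame_embed //.
by rewrite wedge_refl scaler0 !scale0r scale1r subrr addr0 sub0r opprK.
Qed.

Lemma MmatE nu lam p : U p ->
  Mmat nu u lam p =
    wedge e1 (b (Dx (Dx u) p)) + energy nu p *: wedge e1 (b (u p))
    + wedge (b (u p)) (b (Dx u p))
    + lam *: (- wedge e0 (b (Dx u p)) + energy nu p *: wedge e0 e1)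
    - lam ^+ 2 *: wedge e1 (b (u p)) - lam ^+ 3 *: wedge e0 e1.
Proof.
by move=> Up; rewrite /Mmat M2E // M3E // /M1 /M0 L01E L10E !scalerN.
Qed.

Lemma Dx_MmatE nu lam p : U p ->
  Dx (Mmat nu u lam) p =
    wedge e1 (b (Dx (Dx (Dx u)) p))
    + (energy nu p *: wedge e1 (b (Dx u p))
       + inner (u p) (Dx u p) *: wedge e1 (b (u p)))
    + wedge (b (u p)) (b (Dx (Dx u) p))
    + lam *: (- wedge e0 (b (Dx (Dx u) p)) + inner (u p) (Dx u p) *: wedge e0 e1)
    - lam ^+ 2 *: wedge e1 (b (Dx u p)).
Proof.
move=> Up.
have [h0 _] := is_derive_smooth [::] Up.
have [h1 _] := is_derive_smooth [:: true] Up.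
have [h2 _] := is_derive_smooth [:: true; true] Up.
have he := is_derive_energy nu Up.
have hw := is_derive_cst (wedge e0 e1) p ((1, 0) : R * R).
have d1 := is_derive_wedge_embed e1 h2.
have d2 := is_derive_scale he (is_derive_wedge_embed e1 h0).
have d3 := is_derive_wedge (is_derive_embed h0) (is_derive_embed h1).
have d4 := is_deriveN (is_derive_wedge_embed e0 h1).
have d5 := is_deriveZ lam (is_deriveD d4 (is_derive_scale he hw)).
have d6 := is_deriveZ (lam ^+ 2) (is_derive_wedge_embed e1 h0).
have d7 := is_deriveZ (lam ^+ 3) hw.
have d := is_deriveD (is_deriveD (is_deriveD d1 d2) d3) d5.
have {}d := is_deriveB (is_deriveB d d6) d7.
rewrite /Dx (@derive_val _ _ _ _ _ _ _ (is_derive_on (MmatE nu lam) Up d)).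
by rewrite !scaler0 subr0 add0r wedge_refl add0r.
Qed.

(** The left side depends on lambda, the right side does not: one equation for
    u suffices for the whole family. *)
Lemma curvatureE nu lam p : U p ->
  curvature (Lmat u lam) (Mmat nu u lam) p =
  wedge e1 (b (Dx (Dx (Dx u)) p + (nu + 3 / 2 * inner (u p) (u p)) *: Dx u p
               - Dt u p)).
Proof.
move=> Up; rewrite /curvature Dx_MmatE // Dt_LmatE // MmatE // /Lmat L01E L10E.
(* Inner products of u and u_x become those of the embedded vectors. *)
rewrite -(inner_embed (u p) (Dx u p)) wedge_curvature ?inner_frame //.
- rewrite inner_embed /b mulmxBr mulmxDr -scalemxAr.
  have -> : energy nu p + inner (u p) (u p) = nu + 3 / 2 * inner (u p) (u p).
    by rewrite /energy; field.
  by [].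
- by move=> x; rewrite !inE => /or3P[] /eqP ->; rewrite inner_frame_embed.
- by move=> x; rewrite !inE => /or3P[] /eqP ->; rewrite inner_frame_embed.
Qed.

Lemma zero_curvatureP nu :
  zero_curvature U (Lmat u) (Mmat nu u) <->
  forall p : R * R, U p ->
    Dt u p = Dx (Dx (Dx u)) p + (nu + 3 / 2 * inner (u p) (u p)) *: Dx u p.
Proof.
split=> [h p Up | h lam p Up]; last first.
  by rewrite curvatureE // -h // subrr /b mulmx0 wedge0r.
apply/esym/eqP; rewrite -subr_eq0; apply/eqP; apply: (wedge_embed_inj n1).
by rewrite -(curvatureE nu 0 Up); exact: h.
Qed.

Lemma in_o_Lmat lam p : in_o (Lmat u lam p).
Proof.
by rewrite /Lmat L01E L10E; apply: in_oD (in_oZ _ _); exact: wedge_antisym.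
Qed.

Lemma in_o_Mmat nu lam p : U p -> in_o (Mmat nu u lam p).
Proof.
move=> Up; rewrite MmatE //.
by do ![exact: wedge_antisym|apply: in_oD|apply: in_oZ|apply: in_oN].
Qed.

End Curvature.

Theorem mainTheorem3 (R : realType) (n : nat) (hn : (2 <= n)%N)
  (U : set (R * R)) (openU : open U)
  (u : R * R -> 'cV[R]_n.-1) (smooth_u : smooth_on U u) (nu : R) :
  (zero_curvature U (Lmat u) (Mmat nu u) <->
   (forall p : R * R, U p ->
      Dt u p = Dx (Dx (Dx u)) p
               + (nu + 3 / 2 * inner (u p) (u p)) *: Dx u p))
  /\
  o_lax_pair U (Lmat u) (Mmat 0 u)
   (forall p : R * R, U p ->
      Dt u p = Dx (Dx (Dx u)) p + (3 / 2 * norm2 (u p) ^+ 2) *: Dx u p).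
Proof.
have n1 : (1 <= n)%N by exact: ltnW.
split; first exact: zero_curvatureP.
split=> [lam p Up|].
  by split; [exact: in_o_Lmat|exact: in_o_Mmat Up].
have [hz hz'] := zero_curvatureP n1 openU smooth_u 0.
split=> [/hz h p Up|h]; first by rewrite h // add0r norm2_sqr.
by apply: hz' => p Up; rewrite h // add0r norm2_sqr.
Qed.
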